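(* Let $D$ be the derivation of the polynomial ring $\mathbb{Q}[y,z]$ determined by $D(y)=z^2$ and $D(z)=yz$ (this models $D=d/dx$ with $y=\tan x$, $z=\sec x$). Define operators $(Dz)^n$ on $\mathbb{Q}[y,z]$ by $(Dz)^0(f)=f$ and $(Dz)^{n+1}(f)=D\big(z\,(Dz)^n(f)\big)$ for $n\ge 0$. Define numbers $M(n,k)$ and $N(n,k)$ by the expansions $$(Dz)^n(z)=\sum_{k=0}^{\lfloor n/2\rfloor}M(n,k)\,y^{n-2k}z^{n+2k+1},\qquad (Dz)^n(y)=\sum_{k=0}^{\lfloor (n+1)/2\rfloor}N(n,k)\,y^{n-2k+1}z^{n+2k},$$ with the convention that $M(n,k)=N(n,k)=0$ for $k<0$ or $k$ outside the indicated summation ranges. Then for $0\le k\le \lfloor n/2\rfloor$, $$M(n+1,k)=(n+2k+2)M(n,k)+(n-2k+2)M(n,k-1),$$ with $M(0,0)=1$ and $M(0,k)=0$ for $k\ge1$; and $$N(n+1,k)=(n+2k+1)N(n,k)+(n-2k+3)N(n,k-1),$$ with $N(0,0)=1$ and $N(0,k)=0$ for $k\ge 1$.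
   Context: The expansions are understood formally in the polynomial ring $\mathbb{Q}[y,z]$ (where $y,z$ are independent indeterminates), so the coefficients $M(n,k)$ and $N(n,k)$ are uniquely determined. For example $(Dz)(z)=2yz^2$ and $(Dz)(y)=y^2z+z^3$. *)

(* Defs.v *)
From mathcomp Require Import all_boot all_order all_algebra.
From mathcomp Require Import mpoly.
From mathcomp Require Import ring.

Set Implicit Arguments.
Unset Strict Implicit.
Unset Printing Implicit Defensive.

Import Order.TTheory GRing.Theory Num.Theory.

Local Open Scope ring_scope.

Notation Qyz := {mpoly rat[2]}.

Definition y : Qyz := 'X_(0 : 'I_2).
Definition z : Qyz := 'X_(1 : 'I_2).

Definition derivation (K : comNzRingType) (A : algType K) (D : A -> A) : Prop :=
  linear D /\ forall f g, D (f * g) = D f * g + f * D g.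

Definition tan_sec_derivation (D : Qyz -> Qyz) : Prop :=
  [/\ derivation D, D y = z ^+ 2 & D z = y * z].

Lemma tan_sec_derivation_exists : exists D, tan_sec_derivation D.
Proof.
exists (fun f => z ^+ 2 * f^`M(0) + y * z * f^`M(1)); split.
- split=> [a f g|f g].
    by rewrite !linearP /= !mulrDr -!scalerAr scalerDr addrACA.
  rewrite !mderivM; ring.
- rewrite /y !mderivX !mnm1E /= scale0r mulr0 addr0 scale1r.
  by rewrite -{1}[X in (X - _)%MM]add0m addmK mpolyX0 mulr1.
- rewrite /z !mderivX !mnm1E /= scale0r mulr0 add0r scale1r.
  by rewrite -{1}[X in (X - _)%MM]add0m addmK mpolyX0 mulr1.
Qed.

Definition Dz_pow (D : Qyz -> Qyz) (n : nat) (f : Qyz) : Qyz :=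
  iter n (fun g => D (z * g)) f.

(* M and N take an integer second argument because the recurrences mention
   M(n,k-1) and N(n,k-1) with k = 0. *)
Definition M_expansion (D : Qyz -> Qyz) (M : nat -> int -> rat) : Prop :=
  (forall n, Dz_pow D n z =
     \sum_(0 <= k < n./2.+1) M n k%:Z *: (y ^+ (n - 2 * k) * z ^+ (n + 2 * k + 1)))
  /\ (forall n (k : int), ~~ (0 <= k <= (n./2)%:Z) -> M n k = 0).

(* The exponent n-2k+1 of y is written (n + 1) - 2 * k: for n odd and
   k = (n+1)/2, the truncated subtraction n - 2 * k would be off by one. *)
Definition N_expansion (D : Qyz -> Qyz) (N : nat -> int -> rat) : Prop :=
  (forall n, Dz_pow D n y =
     \sum_(0 <= k < (n.+1)./2.+1) N n k%:Z *: (y ^+ (n + 1 - 2 * k) * z ^+ (n + 2 * k)))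
  /\ (forall n (k : int), ~~ (0 <= k <= ((n.+1)./2)%:Z) -> N n k = 0).

(* Main.v *)
(* The operator f |-> D(z f) sends y^a z^b to
   a y^(a-1) z^(b+3) + (b+1) y^(a+1) z^(b+1). Hence the n-th iterate applied to
   y^p z^q is supported on the monomials y^(p+n-2k) z^(q+n+2k), with coefficients
   obeying a two-term triangular recurrence. Distinct monomials being linearly
   independent, the expansion determines the coefficients; M is the case
   (p, q) = (0, 1) and N the case (p, q) = (1, 0). *)
Require Import Defs.
From mathcomp Require Import all_boot all_order all_algebra.
From mathcomp Require Import mpoly.
From mathcomp Require Import ring zify.
From Stdlib Require Import FunctionalExtensionality.

Set Implicit Arguments.
Unset Strict Implicit.
Unset Printing Implicit Defensive.

Import Order.TTheory GRing.Theory Num.Theory.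

Local Open Scope ring_scope.

Lemma derivation_sum (K : comNzRingType) (A : algType K) (D : A -> A)
    (hD : derivation D) (I : Type) (r : seq I) (c : I -> K) (F : I -> A) :
  D (\sum_(i <- r) c i *: F i) = \sum_(i <- r) c i *: D (F i).
Proof.
have D0 : D 0 = 0.
  have [Dlin _] := hD; have := Dlin (-1) 0 0.
  by rewrite scaler0 add0r scaleN1r addNr.
elim: r => [|i r IHr]; first by rewrite !big_nil.
by rewrite !big_cons hD.1 IHr.
Qed.

Lemma derivationX (K : comNzRingType) (A : comAlgType K) (D : A -> A)
    (hD : derivation D) (f : A) (n : nat) :
  D (f ^+ n) = n%:R * (f ^+ n.-1 * D f).
Proof.
have [_ DM] := hD.
have D1 : D 1 = 0.
  by have /(congr1 (+%R^~ (- D 1))) := DM 1 1; rewrite !mulr1 mul1r addrK subrr => <-.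
elim: n => [|[|n] IHn]; first by rewrite expr0 D1 mul0r.
  by rewrite expr0 !mul1r.
by rewrite exprS DM IHn /= -!natr1 !exprS; ring.
Qed.

Definition yz_monomial (p q n k : nat) : Qyz :=
  y ^+ (p + n - 2 * k) * z ^+ (q + n + 2 * k).

(** In the boundary case [2 * k = p + n] the exponent of [y] in the last monomial is truncated, but
    its coefficient is then 0. *)
Lemma D_yz_monomial (D : Qyz -> Qyz) (hD : tan_sec_derivation D) (p q n k : nat) :
  (2 * k <= p + n)%N ->
  D (z * yz_monomial p q n k) =
    (q + n + 2 * k + 1)%:R *: yz_monomial p q n.+1 k
    + (p + n - 2 * k)%:R *: yz_monomial p q n.+1 k.+1.
Proof.
move=> le_k; have [hder Dy Dz] := hD.
rewrite /yz_monomial mulrCA -exprS hder.2 !(derivationX hder) Dy Dz /=.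
have -> : (p + n.+1 - 2 * k = (p + n - 2 * k).+1)%N by lia.
have -> : (p + n.+1 - 2 * k.+1 = (p + n - 2 * k).-1)%N by lia.
have -> : (q + n.+1 + 2 * k = (q + n + 2 * k).+1)%N by lia.
have -> : (q + n.+1 + 2 * k.+1 = (q + n + 2 * k).+3)%N by lia.
have natZ m (f : Qyz) : m%:R *: f = m%:R * f by rewrite scaler_nat mulr_natl.
rewrite addn1 !natZ; move: (y) (z) (p + n - 2 * k)%N (q + n + 2 * k)%N => Y Z a b.
rewrite (exprS Y a) (exprS Z b.+2) (exprS Z b.+1) !(exprS Z b) expr2.
(* The powers become atoms, so [ring] never has to relate [a.-1] to [a]. *)
move: (Y ^+ a) (Y ^+ a.-1) (Z ^+ b) (a%:R : Qyz) (b.+1%:R : Qyz) => Ya Ya' Zb A B.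
by ring.
Qed.

Lemma yz_monomialE (p q n k : nat) :
  yz_monomial p q n k =
    'X_[U_(0 : 'I_2) *+ (p + n - 2 * k) + U_(1 : 'I_2) *+ (q + n + 2 * k)].
Proof. by rewrite /yz_monomial /y /z mpolyXD !mpolyXn. Qed.

Lemma mcoeff_yz_sum (p q n K k0 : nat) (c : nat -> rat) : (k0 < K)%N ->
  (\sum_(0 <= k < K) c k *: yz_monomial p q n k)@_
    (U_(0 : 'I_2) *+ (p + n - 2 * k0) + U_(1 : 'I_2) *+ (q + n + 2 * k0)) = c k0.
Proof.
move=> lt_k0; rewrite raddf_sum /= (bigD1_seq k0) ?mem_index_iota ?iota_uniq //=.
rewrite mcoeffZ yz_monomialE mcoeffX eqxx mulr1 big1 ?addr0 // => k ne_k.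
(* The exponent of [z] alone separates the monomials: it involves no truncated subtraction and is
   injective in [k]. *)
rewrite mcoeffZ yz_monomialE mcoeffX; case: eqP => [/mnmP/(_ 1)|_]; last by rewrite mulr0.
by rewrite !mnmDE !mulmnE !mnm1E /=; move: ne_k; lia.
Qed.

Definition yz_expansion (D : Qyz -> Qyz) (p q : nat) (C : nat -> int -> rat) : Prop :=
  (forall n, Dz_pow D n (y ^+ p * z ^+ q) =
     \sum_(0 <= k < (p + n)./2.+1) C n k%:Z *: yz_monomial p q n k)
  /\ (forall n (k : int), ~~ (0 <= k <= ((p + n)./2)%:Z) -> C n k = 0).

Lemma yz_expansion_unique (D : Qyz -> Qyz) (p q : nat) (C C' : nat -> int -> rat) :
  yz_expansion D p q C -> yz_expansion D p q C' -> C = C'.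
Proof.
move=> [expC outC] [expC' outC'].
apply: functional_extensionality => n; apply: functional_extensionality => k.
have [|out] := boolP (0 <= k <= ((p + n)./2)%:Z); last by rewrite outC ?outC'.
case: k => // k /andP[_ le_k].
have lt_k : (k < (p + n)./2.+1)%N by lia.
rewrite -(mcoeff_yz_sum p q n (fun k => C n k%:Z) lt_k).
by rewrite -(mcoeff_yz_sum p q n (fun k => C' n k%:Z) lt_k) -expC -expC'.
Qed.

(** The recurrence itself serves as the definition, over all integers [k], so what remains to prove
    is that these numbers are the expansion coefficients. *)
Fixpoint yz_coef (p q n : nat) (k : int) : rat :=
  if n is m.+1 then
    ((q + m)%:Z + 2 * k + 1)%:~R * yz_coef p q m k
    + ((p + m)%:Z - 2 * k + 2)%:~R * yz_coef p q m (k - 1)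
  else (k == 0)%:R.

Lemma yz_coef_neg (p q n : nat) (k : int) : k < 0 -> yz_coef p q n k = 0.
Proof.
elim: n k => [|n IHn] k lt_k /=; first by rewrite lt_eqF.
by rewrite !IHn ?mulr0 ?addr0 //; lia.
Qed.

Lemma yz_coef_large (p q n : nat) (k : int) :
  (p + n)%:Z < 2 * k -> yz_coef p q n k = 0.
Proof.
elim: n k => [|n IHn] k lt_k /=; first by case: eqP => // ?; lia.
rewrite IHn ?mulr0 ?add0r; last by lia.
have [/IHn->|le_k] := ltP (p + n)%:Z (2 * (k - 1)); first by rewrite mulr0.
(* Only [2 * k = p + n + 2] is left, where the factor of the [k - 1] term vanishes. *)
have -> : (p + n)%:Z - 2 * k + 2 = 0 by lia.
by rewrite mulr0z mul0r.
Qed.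

(* The number K of terms is left free so that the iterates n and n + 1 can be
   compared over the same range. *)
Lemma Dz_pow_yz_coef (D : Qyz -> Qyz) (hD : tan_sec_derivation D) (p q n K : nat) :
  (p + n < 2 * K)%N ->
  Dz_pow D n (y ^+ p * z ^+ q) =
    \sum_(0 <= k < K) yz_coef p q n k%:Z *: yz_monomial p q n k.
Proof.
elim: n K => [|n IHn] [|K] lt_K; try by lia.
  rewrite big_nat_recl // big1 ?addr0 => [|k _]; last by rewrite scale0r.
  by rewrite /= scale1r /yz_monomial !addn0 subn0.
rewrite /Dz_pow iterS -/(Dz_pow D n _) (IHn K.+1) ?mulr_sumr; last by lia.
under eq_bigr do rewrite -scalerAr.
have [hder _ _] := hD; rewrite (derivation_sum hder).
under eq_bigr => k _.
  have -> : yz_coef p q n k%:Z *: D (z * yz_monomial p q n k) =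
      (((q + n)%:Z + 2 * k%:Z + 1)%:~R * yz_coef p q n k%:Z) *: yz_monomial p q n.+1 k
      + (((p + n)%:Z - 2 * k%:Z)%:~R * yz_coef p q n k%:Z) *: yz_monomial p q n.+1 k.+1.
    (* Past [2 * k = p + n] the truncated exponents are meaningless, but the coefficient is 0
       there. *)
    have [le_k|lt_k] := leqP (2 * k) (p + n).
      rewrite (D_yz_monomial hD) // scalerDr !scalerA ![_%:~R * _]mulrC.
      by congr ((_ * _) *: _ + (_ * _) *: _); rewrite pmulrn; congr _%:~R; lia.
    by rewrite yz_coef_large ?mulr0 ?scale0r ?addr0 //; lia.
  over.
rewrite big_split /= [X in _ + X]big_nat_recr //=.
(* The shifted sum overshoots the range by this one term. Since [p + n <= 2 * K], either the
   coefficient or, at equality, the integer factor is 0. *)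
have -> : ((p + n)%:Z - 2 * K%:Z)%:~R * yz_coef p q n K%:Z = 0.
  have [/yz_coef_large->|le_K] := ltP (p + n)%:Z (2 * K%:Z); first by rewrite mulr0.
  have -> : (p + n)%:Z - 2 * K%:Z = 0 by lia.
  by rewrite mulr0z mul0r.
rewrite scale0r addr0.
under [RHS]eq_bigr do rewrite scalerDl.
rewrite big_split /=; congr (_ + _); rewrite [RHS]big_nat_recl //.
(* At [k = 0] the recurrence refers to index -1, which contributes nothing; the other terms match
   after the shift. *)
rewrite yz_coef_neg // mulr0 scale0r add0r.
apply: eq_bigr => k _; congr ((_%:~R * yz_coef _ _ _ _) *: _); lia.
Qed.

Lemma yz_expansion_coef (D : Qyz -> Qyz) (hD : tan_sec_derivation D) (p q : nat) :
  yz_expansion D p q (yz_coef p q).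
Proof.
split=> [n|n k out]; first by apply: (Dz_pow_yz_coef hD); lia.
have [/yz_coef_neg//|k_ge0] := ltP k 0.
by apply: yz_coef_large; lia.
Qed.

Lemma M_expansionE (D : Qyz -> Qyz) (M : nat -> int -> rat) :
  M_expansion D M <-> yz_expansion D 0 1 M.
Proof.
rewrite /M_expansion /yz_expansion expr0 expr1 mul1r.
suff E n : \sum_(0 <= k < n./2.+1)
      M n k%:Z *: (y ^+ (n - 2 * k) * z ^+ (n + 2 * k + 1)) =
    \sum_(0 <= k < (0 + n)./2.+1) M n k%:Z *: yz_monomial 0 1 n k.
  by split=> -[exp out]; split=> // n; rewrite exp E.
by apply: eq_bigr => k _; rewrite /yz_monomial addn1.
Qed.

Lemma N_expansionE (D : Qyz -> Qyz) (N : nat -> int -> rat) :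
  N_expansion D N <-> yz_expansion D 1 0 N.
Proof.
rewrite /N_expansion /yz_expansion expr0 expr1 mulr1.
suff E n : \sum_(0 <= k < (n.+1)./2.+1)
      N n k%:Z *: (y ^+ (n + 1 - 2 * k) * z ^+ (n + 2 * k)) =
    \sum_(0 <= k < (1 + n)./2.+1) N n k%:Z *: yz_monomial 1 0 n k.
  by split=> -[exp out]; split=> // n; rewrite exp E.
by apply: eq_bigr => k _; rewrite /yz_monomial addn1.
Qed.

Theorem theorem1 (D : Qyz -> Qyz) (hD : tan_sec_derivation D) :
  (exists! M : nat -> int -> rat, M_expansion D M) /\
  (exists! N : nat -> int -> rat, N_expansion D N) /\
  (forall M N : nat -> int -> rat, M_expansion D M -> N_expansion D N ->
     ((forall (n : nat) (k : int), 0 <= k <= (n./2)%:Z ->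
         M n.+1 k = (n%:Z + 2 * k + 2)%:~R * M n k
                    + (n%:Z - 2 * k + 2)%:~R * M n (k - 1)) /\
      M 0%N 0 = 1 /\
      (forall k : int, 1 <= k -> M 0%N k = 0)) /\
     ((forall (n : nat) (k : int), 0 <= k <= (n./2)%:Z ->
         N n.+1 k = (n%:Z + 2 * k + 1)%:~R * N n k
                    + (n%:Z - 2 * k + 3)%:~R * N n (k - 1)) /\
      N 0%N 0 = 1 /\
      (forall k : int, 1 <= k -> N 0%N k = 0))).
Proof.
have expC p q := yz_expansion_coef hD p q.
split; [|split].
- exists (yz_coef 0 1); split=> [|M /M_expansionE]; first exact/M_expansionE.
  exact: yz_expansion_unique.
- exists (yz_coef 1 0); split=> [|N /N_expansionE]; first exact/N_expansionE.
  exact: yz_expansion_unique.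
(* By uniqueness [M] and [N] become instances of [yz_coef], whose unfolding gives the recurrences up
   to rearranging the integer factors. *)
move=> M N /M_expansionE/yz_expansion_unique/(_ (expC 0 1)%N)->.
move=> /N_expansionE/yz_expansion_unique/(_ (expC 1 0)%N)->.
split; split=> [n k _|]; try by split=> // k lt_k /=; rewrite gt_eqF //; lia.
- by congr (_%:~R * _ + _%:~R * _); lia.
- by congr (_%:~R * _ + _%:~R * _); lia.
Qed.
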